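(* Let $0\le\beta<1$ and $\mu>0$. Let $\mathcal{X}\subset\mathbb{R}^n$ be a nonempty convex compact set such that $\|x-y\|\le R$ for all $x,y\in\mathcal{X}$, where $R>0$. For $t\in\{1,\dots,T\}$ let $f_t,r_t:\mathcal{X}\to\mathbb{R}$ be closed convex functions (not necessarily differentiable), with each $f_t$ being $\mu$-strongly convex, let $F_t=f_t+r_t$, and suppose that $\|\tilde\nabla F_t(x)\|\le M$ for all $x\in\mathcal{X}$ and all $t$, where $M>0$. Let $u_1,\dots,u_T\in\mathcal{X}$ be any comparator sequence, and let $x_1,\dots,x_T\in\mathcal{X}$ be generated by the online proximal gradient (OPG) algorithm from an initial point $x_1\in\mathcal{X}$ with the non-increasing step sizes $\eta_t=\frac{\gamma}{t}$, where $$\gamma=\frac{2RT^{-\beta}D_\beta(T)+R^2}{\delta R^2+(\mu-\delta)\frac1T\|u_1-x_1\|^2}$$ and $\delta\in(0,\mu)$ is small enough that $\gamma\delta<1$. Then the dynamic regret satisfies $$\mathbf{Reg}_T^d=\mathcal{O}\left(\log T\,\bigl(1+T^{-\beta}D_\beta(T)\bigr)\right).$$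
   Context: $\|\cdot\|$ is the Euclidean norm and $\langle\cdot,\cdot\rangle$ the Euclidean inner product on $\mathbb{R}^n$. For a convex function $g:\mathcal{X}\to\mathbb{R}$, $\partial g(x)$ is the subdifferential of $g$ at $x$, i.e. the set of $v$ with $g(y)\ge g(x)+\langle v,y-x\rangle$ for all $y\in\mathcal{X}$, and $\tilde\nabla g(x)$ denotes a subgradient in $\partial g(x)$. Here $\tilde\nabla F_t(x)=\tilde\nabla f_t(x)+\tilde\nabla r_t(x)$, where $\tilde\nabla f_t(x)\in\partial f_t(x)$ is the subgradient used by the algorithm and $\tilde\nabla r_t(x)\in\partial r_t(x)$. The function $f_t$ is $\mu$-strongly convex if $f_t(y)\ge f_t(x)+\langle\tilde\nabla f_t(x),y-x\rangle+\frac{\mu}{2}\|x-y\|^2$ for all $x,y\in\mathcal{X}$ and any subgradient $\tilde\nabla f_t(x)\in\partial f_t(x)$. OPG algorithm: given $x_1\in\mathcal{X}$ and step sizes $\eta_t>0$, for $t=1,2,\dots$ set $$x_{t+1}=\arg\min_{x\in\mathcal{X}}\left\{r_t(x)+\langle x,\tilde\nabla f_t(x_t)\rangle+\frac{1}{2\eta_t}\|x-x_t\|^2\right\}.$$ Dynamic regret with respect to the comparators $\{u_t\}_{t=1}^T$: $\mathbf{Reg}_T^d:=\sum_{t=1}^TF_t(x_t)-\sum_{t=1}^TF_t(u_t)$. Extended path variation: $D_\beta(T):=\sum_{t=2}^Tt^\beta\|u_t-u_{t-1}\|$. The $\mathcal{O}(\cdot)$ is with respect to the horizon $T\ge2$,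 with $\delta$ treated as a constant: the hidden constant may depend on $R,M,\mu,\beta,\delta$, but not on $T$, the functions $f_t,r_t$, the comparators $u_t$, or the iterates. *)

(* Defs.v *)
From HB Require Import structures.
From mathcomp Require Import all_boot all_order all_algebra.
From mathcomp Require Import all_classical all_reals all_analysis.

Set Implicit Arguments.
Unset Strict Implicit.
Unset Printing Implicit Defensive.

Import Order.TTheory GRing.Theory Num.Theory.
Import numFieldNormedType.Exports.

Local Open Scope classical_set_scope.
Local Open Scope ring_scope.

(* R^n is 'rV[R]_n. Its library norm `|x| is the sup norm, so the Euclidean
   structure is defined here; the library topology is the Euclidean one.

   A function X -> R is a total function 'rV[R]_n -> R of which only the values
   on X are ever used. Sequences indexed by 1, ..., T are functions on nat of
   which only the values at 1, ..., T are used. *)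

Definition inner (R : realType) (n : nat) (x y : 'rV[R]_n) : R :=
  \sum_(i < n) x 0 i * y 0 i.

Definition enorm (R : realType) (n : nat) (x : 'rV[R]_n) : R :=
  Num.sqrt (inner x x).

(* Closed in the sense of convex analysis: the epigraph of g over X is a closed
   subset of R^n * R. *)
Definition closed_function (R : realType) (n : nat) (X : set 'rV[R]_n)
    (g : 'rV[R]_n -> R) : Prop :=
  closed [set p : 'rV[R]_n * R^o | X p.1 /\ g p.1 <= p.2].

(* Only test points of X enter, so normal directions to X at x are allowed. *)
Definition subdifferential (R : realType) (n : nat) (X : set 'rV[R]_n)
    (g : 'rV[R]_n -> R) (x : 'rV[R]_n) : set 'rV[R]_n :=
  [set v | forall y, X y -> g x + inner v (y - x) <= g y].

Definition strongly_convex (R : realType) (n : nat) (X : set 'rV[R]_n)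
    (mu : R) (g : 'rV[R]_n -> R) : Prop :=
  forall x y v, X x -> X y -> subdifferential X g x v ->
    g x + inner v (y - x) + mu / 2 * enorm (x - y) ^+ 2 <= g y.

Definition subgradient_selection (R : realType) (n : nat) (X : set 'rV[R]_n)
    (g : 'rV[R]_n -> R) (dg : 'rV[R]_n -> 'rV[R]_n) : Prop :=
  forall x, X x -> subdifferential X g x (dg x).

Definition argmin_on (R : realType) (n : nat) (X : set 'rV[R]_n)
    (phi : 'rV[R]_n -> R) : set 'rV[R]_n :=
  [set x | X x /\ forall y, X y -> phi x <= phi y].

(* df t is the subgradient selection of f_t that the algorithm queries. *)
Definition opg_iterates (R : realType) (n : nat) (X : set 'rV[R]_n)
    (r : nat -> 'rV[R]_n -> R) (df : nat -> 'rV[R]_n -> 'rV[R]_n)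
    (eta : nat -> R) (T : nat) (x : nat -> 'rV[R]_n) : Prop :=
  X (x 1%N) /\
  forall t : nat, (1 <= t < T)%N ->
    argmin_on X
      (fun z => r t z + inner z (df t (x t))
                + (2 * eta t)^-1 * enorm (z - x t) ^+ 2)
      (x t.+1).

Definition dynamic_regret (R : realType) (n : nat)
    (F : nat -> 'rV[R]_n -> R) (T : nat) (x u : nat -> 'rV[R]_n) : R :=
  \sum_(1 <= t < T.+1) F t (x t) - \sum_(1 <= t < T.+1) F t (u t).

Definition path_variation (R : realType) (n : nat) (beta : R) (T : nat)
    (u : nat -> 'rV[R]_n) : R :=
  \sum_(2 <= t < T.+1) t%:R `^ beta * enorm (u t - u t.-1).

(* D is the bound on the diameter of X; eta_t = step_gamma / t. *)
Definition step_gamma (R : realType) (n : nat) (D mu beta delta : R) (T : nat)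
    (u : nat -> 'rV[R]_n) (x1 : 'rV[R]_n) : R :=
  (2 * D * T%:R `^ (- beta) * path_variation beta T u + D ^+ 2)
  / (delta * D ^+ 2 + (mu - delta) * T%:R^-1 * enorm (u 1%N - x1) ^+ 2).

(* Main.v *)
(* Strong convexity of f_t and of the proximal objective bound the regret of round
   t < T by (eta_t / 2) M^2 + (t / (2 gamma)) (a_t - b_t) - (mu / 2) a_t, where
   a_t = ||u_t - x_t||^2 and b_t = ||u_t - x_{t+1}||^2. Since
   a_{t+1} <= b_t + 2 D ||u_{t+1} - u_t||, summation by parts bounds the sum of the
   last two terms by ((1 / gamma) (A + 2 D T P) - mu A) / 2 with A the sum of the a_t
   and P = T^{-beta} D_beta(T). Splitting mu = delta + (mu - delta) and using
   a_1 <= A <= T D^2, this is nonpositive: gamma is exactly the value for which the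
   resulting bound vanishes, and gamma delta < 1 gives the sign needed for the upper
   bound on A. What is left is harmonic: gamma M^2 (1 + ln T) / 2, with
   gamma = O(1 + P). *)
Require Import Defs.
From HB Require Import structures.
From mathcomp Require Import all_boot all_order all_algebra.
From mathcomp Require Import all_classical all_reals all_analysis.
From mathcomp Require Import ring lra.

Set Implicit Arguments.
Unset Strict Implicit.
Unset Printing Implicit Defensive.

Import Order.TTheory GRing.Theory Num.Theory.
Import numFieldNormedType.Exports.

Local Open Scope classical_set_scope.
Local Open Scope ring_scope.

(** * Euclidean geometry and first-order optimality of a proximal step *)

Section EuclideanSpace.
Context {R : realType} {n : nat}.
Implicit Types (x y z v : 'rV[R]_n) (k : R).

Lemma innerC x y : inner x y = inner y x.
Proof. by apply: eq_bigr => i _; rewrite mulrC. Qed.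

Lemma innerDl x y z : inner (x + y) z = inner x z + inner y z.
Proof. by rewrite -big_split; apply: eq_bigr => i _; rewrite !mxE mulrDl. Qed.

Lemma innerZl k x z : inner (k *: x) z = k * inner x z.
Proof. by rewrite /inner mulr_sumr; apply: eq_bigr => i _; rewrite mxE mulrA. Qed.

Lemma innerNl x z : inner (- x) z = - inner x z.
Proof. by rewrite -scaleN1r innerZl mulN1r. Qed.

Lemma innerDr x y z : inner z (x + y) = inner z x + inner z y.
Proof. by rewrite !(innerC z) innerDl. Qed.

Lemma innerZr k x z : inner z (k *: x) = k * inner z x.
Proof. by rewrite !(innerC z) innerZl. Qed.

Lemma innerNr x z : inner z (- x) = - inner z x.
Proof. by rewrite !(innerC z) innerNl. Qed.

Definition innerE := (innerDl, innerDr, innerNl, innerNr, innerZl, innerZr).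

Lemma inner_ge0 x : 0 <= inner x x.
Proof. by apply: sumr_ge0 => i _; rewrite -expr2 sqr_ge0. Qed.

Lemma enorm_ge0 x : 0 <= enorm x.
Proof. exact: sqrtr_ge0. Qed.

Lemma enorm_sqr x : enorm x ^+ 2 = inner x x.
Proof. by rewrite sqr_sqrtr ?inner_ge0. Qed.

Lemma enormB x y : enorm (x - y) = enorm (y - x).
Proof. by rewrite /enorm -opprB innerNl innerNr opprK. Qed.

Lemma enorm_eq0 x : enorm x = 0 -> x = 0.
Proof.
move=> x0; have /eqP : inner x x = 0 by rewrite -enorm_sqr x0 expr0n.
rewrite psumr_eq0 => [/allP/= xx0|i _]; last by rewrite -expr2 sqr_ge0.
apply/rowP => i; rewrite mxE; apply/eqP.
by have := xx0 i (mem_index_enum i); rewrite mulf_eq0 orbb.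
Qed.

Lemma cauchy_schwarz x y : inner x y <= enorm x * enorm y.
Proof.
have [/enorm_eq0->|x0] := eqVneq (enorm x) 0.
  by rewrite -(scale0r 0) innerZl mul0r mulr_ge0 ?enorm_ge0.
have [/enorm_eq0->|y0] := eqVneq (enorm y) 0.
  by rewrite -(scale0r 0) innerZr mul0r mulr_ge0 ?enorm_ge0.
(* This square expands to [2 * |x| * |y| * (|x| * |y| - inner x y)], with [|.|] for [enorm]. *)
have := inner_ge0 (enorm y *: x - enorm x *: y).
rewrite !innerE -!enorm_sqr (innerC y x).
have xy : 0 < enorm x * enorm y by rewrite mulr_gt0 // lt_def ?x0 ?y0 enorm_ge0.
move=> h; rewrite -(ler_pM2l xy); lra.
Qed.

Lemma enorm_sqrB x y : enorm x ^+ 2 - enorm y ^+ 2 = inner (x - y) (x + y).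
Proof. by rewrite !enorm_sqr !innerE (innerC y x); ring. Qed.

(** The difference of squares is the inner product of [x - y] with [(x - z) + (y - z)], two vectors
    of length at most [D]. *)
Lemma enorm_sqr_lipschitz (D : R) x y z : enorm (x - z) <= D -> enorm (y - z) <= D ->
  enorm (x - z) ^+ 2 <= enorm (y - z) ^+ 2 + 2 * D * enorm (x - y).
Proof.
move=> xD yD; rewrite -lerBlDl enorm_sqrB.
have -> : x - z - (y - z) = x - y by rewrite opprB addrA subrK.
rewrite innerDr.
have := cauchy_schwarz (x - y) (x - z).
have := cauchy_schwarz (x - y) (y - z).
have := ler_wpM2l (enorm_ge0 (x - y)) xD.
have := ler_wpM2l (enorm_ge0 (x - y)) yD.
lra.
Qed.

(** Young's inequality: expand the square of [e *: x - y] and divide by [2 * e]. *)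
Lemma inner_le_half_sqr (M e : R) x y : 0 < e -> enorm x <= M ->
  inner x y <= e / 2 * M ^+ 2 + (2 * e)^-1 * enorm y ^+ 2.
Proof.
move=> e0 xM.
have xM2 : enorm x ^+ 2 <= M ^+ 2.
  by rewrite ler_sqr ?nnegrE ?enorm_ge0 ?(le_trans (enorm_ge0 x)).
have := inner_ge0 (e *: x - y); rewrite !innerE (innerC y x) -!enorm_sqr => h.
have e2 : 0 < 2 * e by lra.
rewrite -(ler_pM2l e2) mulrDr mulVKf ?gt_eqF //.
have := ler_wpM2l (sqr_ge0 e) xM2; lra.
Qed.

(* First-order optimality along the segment from [xp] to [y]: the increments of
   the objective have the form [s * (A + s * B)] and are nonnegative for all
   [0 < s <= 1], so [A >= 0]. *)
Lemma argmin_three_point (X : set 'rV[R]_n) (r : 'rV[R]_n -> R) (g x xp y : 'rV[R]_n)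
    (c : R) :
  convex_set X -> convex_function X r ->
  argmin_on X (fun z => r z + inner z g + c * enorm (z - x) ^+ 2) xp -> X y ->
  r xp + inner xp g + c * enorm (xp - x) ^+ 2 + c * enorm (y - xp) ^+ 2
    <= r y + inner y g + c * enorm (y - x) ^+ 2.
Proof.
move=> cX cr [Xxp xp_min] Xy.
pose A := r y - r xp + inner (y - xp) g + 2 * c * inner (y - xp) (xp - x).
pose B := c * inner (y - xp) (y - xp).
have AB (s : R) : 0 < s -> s <= 1 -> 0 <= A + s * B.
  move=> s0 s1; have s01 : (0 <= s) && (s <= 1) by rewrite ltW.
  pose k : {i01 R} := Itv01 (ltW s0) s1.
  have Xk : X (s *: y + (1 - s) *: xp).
    by have := cX y xp k (mem_set Xy) (mem_set Xxp); rewrite inE.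
  have rk : r (s *: y + (1 - s) *: xp) <= s * r y + (1 - s) * r xp.
    exact: (cr k y xp (mem_set Xy) (mem_set Xxp)).
  have := xp_min _ Xk => /= h; rewrite -(pmulr_rge0 _ s0).
  move: h; rewrite /A /B !enorm_sqr !innerE (innerC x xp) (innerC y xp) (innerC x y).
  lra.
have A0 : 0 <= A.
  rewrite leNgt; apply/negP => A_lt0.
  (* The case [s = 1] gives [B >= - A > 0], so [s = - A / (2 * B)] lies in [(0, 1]]; there
     [A + s * B = A / 2 < 0], a contradiction. *)
  have := AB 1 ltr01 (lexx _); rewrite mul1r => AB1.
  have B0 : 0 < B by lra.
  have s0 : 0 < - A / (2 * B) by rewrite divr_gt0; lra.
  have s1 : - A / (2 * B) <= 1 by rewrite ler_pdivrMr; lra.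
  have := AB _ s0 s1.
  have -> : A + - A / (2 * B) * B = A / 2 by field; rewrite gt_eqF.
  lra.
move: A0; rewrite /A !enorm_sqr !innerE (innerC x xp) (innerC x y) (innerC y xp).
lra.
Qed.

End EuclideanSpace.

(** * Harmonic sums and summation by parts *)

Lemma ln_ge_1sub_inv (R : realType) (x : R) : 0 < x -> 1 - x^-1 <= ln x.
Proof.
move=> x0; have xV0 : 0 < x^-1 by rewrite invr_gt0.
have := @le_ln1Dx R (x^-1 - 1).
rewrite (_ : 1 + _ = x^-1) ?lnV ?posrE //; [lra | ring].
Qed.

(** Each new term [1 / (T + 2)] equals [1 - (T + 1) / (T + 2)], hence is at most
    [ln (T + 2) - ln (T + 1)], and these telescope. *)
Lemma sum_inv_le_ln (R : realType) (T : nat) : (0 < T)%N ->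
  \sum_(1 <= t < T.+1) t%:R^-1 <= 1 + ln T%:R :> R.
Proof.
case: T => // T _; elim: T => [|T IH]; first by rewrite big_nat1 invr1 ln1 addr0.
rewrite big_nat_recr //=.
have T1 : 0 < T.+1%:R :> R by rewrite ltr0n.
have T2 : 0 < T.+2%:R :> R by rewrite ltr0n.
have := @ln_ge_1sub_inv R (T.+2%:R / T.+1%:R) (divr_gt0 T2 T1).
rewrite ln_div ?posrE // invf_div.
have -> : 1 - T.+1%:R / T.+2%:R = T.+2%:R^-1 :> R.
  by rewrite -[X in X - _](mulfV (lt0r_neq0 T2)) -mulrBl -natrB // subSnn mul1r //.
by move=> h; apply: le_trans (lerD IH h) _; lra.
Qed.

(** Keeping [m * a (m + 1)] on the left makes the induction close: together with the new
    [(m + 1) * a (m + 1)] it leaves exactly one extra [a (m + 1)] on the right. *)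
Lemma sum_weighted_drift_le (R : realType) (a b d : nat -> R) (m : nat) :
  (forall t, (1 <= t <= m)%N -> a t.+1 <= b t + d t) ->
  \sum_(1 <= t < m.+1) t%:R * (a t - b t) + m%:R * a m.+1
    <= \sum_(1 <= t < m.+1) a t + \sum_(1 <= t < m.+1) t%:R * d t.
Proof.
elim: m => [|m IH] ab; first by rewrite !big_nil mul0r !addr0.
have {}IH : \sum_(1 <= t < m.+1) t%:R * (a t - b t) + m%:R * a m.+1
    <= \sum_(1 <= t < m.+1) a t + \sum_(1 <= t < m.+1) t%:R * d t.
  by apply: IH => t /andP[t1 tm]; apply: ab; rewrite t1 ltnW.
rewrite !(@big_nat_recr _ _ _ m.+1) //=.
have := ler_wpM2l (ler0n R m.+1) (ab m.+1 (leqnn _)).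
rewrite -natr1 in IH *; lra.
Qed.

(** Termwise, [t <= t + 1 = (t + 1)^(1 - beta) * (t + 1)^beta], and the first factor is at most
    [T^(1 - beta)] because [t + 1 <= T] and [beta <= 1]. *)
Lemma sum_weighted_path_le (R : realType) (n : nat) (beta : R) (T : nat)
    (u : nat -> 'rV[R]_n) : 0 <= beta <= 1 ->
  \sum_(1 <= t < T) t%:R * enorm (u t.+1 - u t)
    <= T%:R * (T%:R `^ (- beta) * path_variation beta T u).
Proof.
move=> /andP[beta0 beta1]; rewrite /path_variation [in leRHS]big_add1 !mulr_sumr /=.
apply: ler_sum_nat => t /andP[t1 tT].
rewrite !mulrA ler_wpM2r ?enorm_ge0 //.
have T0 : 0 < T%:R :> R by rewrite ltr0n (leq_ltn_trans _ tT).
have t0 : 0 < t.+1%:R :> R by rewrite ltr0n.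
have powS (x : R) : 0 < x -> x * x `^ (- beta) = x `^ (1 - beta).
  move=> x0; rewrite powRD; last by rewrite (gt_eqF x0) implybT.
  by rewrite powRr1 // ltW.
rewrite powS //; apply: (@le_trans _ _ t.+1%:R); first by rewrite ler_nat.
have {1}-> : t.+1%:R = t.+1%:R `^ (1 - beta) * t.+1%:R `^ beta :> R.
  rewrite -powRD; last by rewrite (gt_eqF t0) implybT.
  by rewrite subrK powRr1 // ltW.
rewrite ler_wpM2r ?powR_ge0 // ge0_ler_powR ?nnegrE ?ler_nat ?subr_ge0 // ltW.
Qed.

(** * Regret of a single round *)

Lemma subgradient_gap_le (R : realType) (n : nat) (X : set 'rV[R]_n)
    (f r : 'rV[R]_n -> R) (M D : R) (g h x y : 'rV[R]_n) :
  subdifferential X f x g -> subdifferential X r x h -> X y ->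
  enorm (g + h) <= M -> enorm (x - y) <= D ->
  f x + r x - (f y + r y) <= M * D.
Proof.
move=> /(_ y) sf /(_ y) sr Xy gM xD.
have := cauchy_schwarz (g + h) (x - y).
have := ler_pM (enorm_ge0 _) (enorm_ge0 _) gM xD.
move: (sf Xy) (sr Xy); rewrite !innerE; lra.
Qed.

(** Adding strong convexity of [f] at [x], the subgradient inequality of [r] between [x] and [xp],
    and the three-point inequality leaves [inner (g + h) (x - xp)]. Young's inequality bounds it,
    and its quadratic part cancels the proximal term at [xp]. *)
Lemma opg_round_le (R : realType) (n : nat) (X : set 'rV[R]_n)
    (f r : 'rV[R]_n -> R) (mu M eta : R) (g h x xp y : 'rV[R]_n) :
  convex_set X -> convex_function X r -> strongly_convex X mu f ->
  subdifferential X f x g -> subdifferential X r x h -> X x -> X y ->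
  enorm (g + h) <= M -> 0 < eta ->
  argmin_on X (fun z => r z + inner z g + (2 * eta)^-1 * enorm (z - x) ^+ 2) xp ->
  f x + r x - (f y + r y)
    <= eta / 2 * M ^+ 2
       + (2 * eta)^-1 * (enorm (y - x) ^+ 2 - enorm (y - xp) ^+ 2)
       - mu / 2 * enorm (y - x) ^+ 2.
Proof.
move=> cX cr sf fg rh Xx Xy ghM eta0 xp_min.
have := sf x y g Xx Xy fg.
have := rh xp xp_min.1.
have := argmin_three_point cX cr xp_min Xy.
have := inner_le_half_sqr (x - xp) eta0 ghM.
rewrite (enormB x xp) (enormB x y) !innerE (innerC y g) (innerC xp g).
lra.
Qed.

Theorem theorem2 (R : realType) (D M mu beta delta : R)
    (hD : 0 < D) (hM : 0 < M) (hmu : 0 < mu)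
    (hbeta : 0 <= beta < 1) (hdelta : 0 < delta < mu) :
  exists2 C : R, 0 < C &
    forall (n T : nat) (X : set 'rV[R]_n)
      (f r : nat -> 'rV[R]_n -> R) (df dr : nat -> 'rV[R]_n -> 'rV[R]_n)
      (u x : nat -> 'rV[R]_n),
    let F := fun t z => f t z + r t z in
    let dF := fun t z => df t z + dr t z in
    let gamma := step_gamma D mu beta delta T u (x 1%N) in
    (2 <= T)%N ->
    X !=set0 -> convex_set X -> compact X ->
    (forall y z, X y -> X z -> enorm (y - z) <= D) ->
    (forall t, (1 <= t <= T)%N ->
       [/\ convex_function X (f t), closed_function X (f t),
           convex_function X (r t) & closed_function X (r t)]) ->
    (forall t, (1 <= t <= T)%N -> strongly_convex X mu (f t)) ->
    (forall t, (1 <= t <= T)%N ->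
       subgradient_selection X (f t) (df t) /\
       subgradient_selection X (r t) (dr t)) ->
    (forall t z, (1 <= t <= T)%N -> X z -> enorm (dF t z) <= M) ->
    (forall t, (1 <= t <= T)%N -> X (u t)) ->
    opg_iterates X r df (fun t => gamma / t%:R) T x ->
    gamma * delta < 1 ->
    dynamic_regret F T x u
      <= C * (ln T%:R * (1 + T%:R `^ (- beta) * path_variation beta T u)).
Proof.
have /andP[delta0 deltamu] := hdelta.
have /andP[beta0 beta1] := hbeta.
(* The first summand comes from the harmonic part, with [1 + ln T <= 3 * ln T]; the second absorbs
   the last round. *)
pose K := 3 / 2 * M ^+ 2 * (2 / (delta * D) + delta^-1) + 2 * (M * D).
have MD0 : 0 < M * D by rewrite mulr_gt0.
have deltaD0 : 0 < 2 / (delta * D) by rewrite divr_gt0 ?mulr_gt0.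
have deltaV0 : 0 < delta^-1 by rewrite invr_gt0.
have M20 : 0 < M ^+ 2 by rewrite exprn_gt0.
exists K; first by rewrite addr_gt0 ?mulr_gt0 ?addr_gt0.
move=> n [|[|m]] // X f r df dr u x F dF gamma _ _ cX _ XD fr_cvx f_strong subg dF_le Xu.
move=> [Xx1 x_min] gammadelta.
pose T := m.+2.
pose P := T%:R `^ (- beta) * path_variation beta T u.
have P0 : 0 <= P.
  by rewrite mulr_ge0 ?powR_ge0 // sumr_ge0 // => t _; rewrite mulr_ge0 ?powR_ge0 ?enorm_ge0.
have T0 : 0 < T%:R :> R by rewrite ltr0n.
pose a t := enorm (u t - x t) ^+ 2.
have a0 t : 0 <= a t := sqr_ge0 _.
pose b t := enorm (u t - x t.+1) ^+ 2.
pose den := delta * D ^+ 2 + (mu - delta) * T%:R^-1 * a 1%N.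
have D20 : 0 < D ^+ 2 by rewrite exprn_gt0.
have deltaD2 : 0 < delta * D ^+ 2 by rewrite mulr_gt0.
have den_ge : delta * D ^+ 2 <= den.
  by rewrite lerDl mulr_ge0 // mulr_ge0 // ?subr_ge0 ?invr_ge0 // ltW.
have den0 : 0 < den := lt_le_trans deltaD2 den_ge.
have DP0 : 0 <= D * P by rewrite mulr_ge0 // ltW.
have gammaE : gamma = (2 * D * P + D ^+ 2) / den by rewrite /P mulrA.
have num0 : 0 < 2 * D * P + D ^+ 2 by lra.
have gamma0 : 0 < gamma by rewrite gammaE divr_gt0.
have gammaV : (2 * D * P + D ^+ 2) / gamma = den.
  by rewrite gammaE invf_div mulrC divfK ?gt_eqF.
have gamma_le : gamma <= (2 / (delta * D) + delta^-1) * (1 + P).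
  have D0' : D != 0 by rewrite gt_eqF.
  have d0' : delta != 0 by rewrite gt_eqF.
  have gamma_le1 : gamma <= (2 * D * P + D ^+ 2) / (delta * D ^+ 2).
    by rewrite gammaE ler_pM2l // lef_pV2 ?posrE.
  apply: le_trans gamma_le1 _.
  have -> : (2 * D * P + D ^+ 2) / (delta * D ^+ 2) = 2 / (delta * D) * P + delta^-1.
    by field; rewrite D0' d0'.
  have := mulr_ge0 (ltW deltaV0) P0; lra.
have Xx t : (1 <= t <= T)%N -> X (x t).
  by case: t => [|[|t]] // /andP[_ tT]; have [] := x_min t.+1 tT.
have uxD t : (1 <= t <= T)%N -> enorm (u t - x t) <= D.
  by move=> tT; apply: XD; [exact: Xu | exact: Xx].
have aD t : (1 <= t <= T)%N -> a t <= D ^+ 2.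
  by move=> tT; rewrite ler_sqr ?nnegrE ?enorm_ge0 ?uxD ?ltW.
have ab t : (1 <= t <= m.+1)%N -> a t.+1 <= b t + 2 * D * enorm (u t.+1 - u t).
  move=> /andP[t1 tm]; have tT : (1 <= t <= T)%N by rewrite t1 leqW.
  by apply: enorm_sqr_lipschitz; apply: XD; [exact: Xu | exact: Xx | exact: Xu | exact: Xx].
have drift : \sum_(1 <= t < T) t%:R * (a t - b t)
    <= \sum_(1 <= t < T) a t + 2 * D * (T%:R * P).
  have := sum_weighted_drift_le ab.
  have := @sum_weighted_path_le _ _ beta T u; rewrite beta0 ltW // => /(_ isT).
  move=> /(ler_wpM2l (ltW hD)).
  have -> : \sum_(1 <= t < m.+2) t%:R * (2 * D * enorm (u t.+1 - u t))
      = 2 * (D * \sum_(1 <= t < m.+2) t%:R * enorm (u t.+1 - u t)).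
    by rewrite !mulr_sumr; apply: eq_bigr => t _; ring.
  have := mulr_ge0 (ler0n R m.+1) (a0 m.+2).
  rewrite -/P -/T; lra.
pose A := \sum_(1 <= t < T) a t.
have A_le : A <= T%:R * D ^+ 2.
  apply: (@le_trans _ _ (\sum_(1 <= t < T) D ^+ 2)).
    by apply: ler_sum_nat => t /andP[t1 tT]; rewrite aD // t1 ltnW.
  by rewrite sumr_const_nat -[_ *+ _]mulr_natl ler_wpM2r ?ltW // ltr_nat.
have A_ge : a 1%N <= A.
  by rewrite /A big_ltn // lerDl sumr_ge0.
have cancellation : gamma^-1 * (A + 2 * D * (T%:R * P)) <= mu * A.
  have gd : 0 <= gamma^-1 - delta.
    by rewrite subr_ge0 -[leRHS]mul1r ler_pdivlMr // mulrC ltW.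
  have h1 := ler_wpM2l gd A_le.
  have md : 0 <= mu - delta by rewrite subr_ge0 ltW.
  have h2 := ler_wpM2l md A_ge.
  (* This reads [T * (2 * D * P + D ^+ 2) / gamma = T * delta * D ^+ 2 + (mu - delta) * a 1]. With
     [h1] it bounds the left side by [delta * A + (mu - delta) * a 1], and [h2] finishes. *)
  have := congr1 ( *%R T%:R) gammaV.
  have -> : T%:R * den = T%:R * (delta * D ^+ 2) + (mu - delta) * a 1%N.
    by rewrite /den; field; rewrite gt_eqF.
  move: h1 h2; lra.
have round t : (1 <= t < T)%N ->
    F t (x t) - F t (u t)
    <= gamma / 2 * M ^+ 2 * t%:R^-1 + (2 * gamma)^-1 * (t%:R * (a t - b t)) - mu / 2 * a t.
  move=> /[dup] tT /andP[t1 tT'].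
  have tT1 : (1 <= t <= T)%N by rewrite t1 ltnW.
  have t0 : 0 < t%:R :> R by rewrite ltr0n.
  have [_ _ r_cvx _] := fr_cvx t tT1.
  have [sf sr] := subg t tT1.
  have := opg_round_le cX r_cvx (f_strong t tT1) (sf _ (Xx t tT1)) (sr _ (Xx t tT1))
    (Xx t tT1) (Xu t tT1) (dF_le t _ tT1 (Xx t tT1)) (divr_gt0 gamma0 t0) (x_min t tT).
  rewrite -/(a t) -/(b t) => h; apply: le_trans h _.
  rewrite le_eqVlt; apply/orP; left; apply/eqP.
  by field; rewrite !gt_eqF.
(* The iterate x_{T+1} is not constrained, so the last round is bounded directly. *)
have last_round : F T (x T) - F T (u T) <= M * D.
  have TT : (1 <= T <= T)%N by rewrite leqnn.
  have [sf sr] := subg T TT.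
  apply: (subgradient_gap_le (sf _ (Xx T TT)) (sr _ (Xx T TT)) (Xu T TT)).
    exact: dF_le T _ TT (Xx T TT).
  by rewrite enormB uxD.
have harmonic_le : \sum_(1 <= t < T) t%:R^-1 <= 1 + ln T%:R :> R.
  apply: le_trans (@sum_inv_le_ln R T isT).
  by rewrite [leRHS]big_nat_recr //= lerDl invr_ge0.
(* As [T >= 2], constants can be traded for multiples of [ln T]: [1 <= 2 * ln T]. *)
have ln_ge : 1 / 2 <= ln T%:R :> R.
  apply: le_trans (ln_ge_1sub_inv T0).
  have : T%:R^-1 <= 2^-1 :> R by rewrite lef_pV2 ?posrE ?ler_nat.
  lra.
have regret_le : dynamic_regret F T x u <= gamma / 2 * M ^+ 2 * (1 + ln T%:R) + M * D.
  rewrite /dynamic_regret -sumrB big_nat_recr //=.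
  apply: lerD => //; apply: le_trans (ler_sum_nat round) _.
  rewrite big_split sumrN big_split -!mulr_sumr /= -/A.
  have c0 : 0 <= gamma / 2 * M ^+ 2 by rewrite mulr_ge0 ?sqr_ge0 // divr_ge0 // ltW.
  have := ler_wpM2l c0 harmonic_le.
  have g0 : 0 <= gamma^-1 by rewrite invr_ge0 ltW.
  (* Half of [drift / gamma] followed by half of [cancellation] makes the terms in [a] and [b] sum
     to at most zero. *)
  have := ler_wpM2l g0 drift.
  rewrite -/A [(2 * gamma)^-1]invfM.
  move: cancellation; lra.
apply: le_trans regret_le _; rewrite -/T -/P.
set L := ln _ in ln_ge *.
have h1 : gamma / 2 * M ^+ 2 * (1 + L)
    <= (2 / (delta * D) + delta^-1) * (1 + P) / 2 * M ^+ 2 * (3 * L).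
  apply: ler_pM; [|lra| |lra]; first by rewrite mulr_ge0 ?sqr_ge0 // divr_ge0 // ltW.
  by rewrite ler_pM2r // ler_pM2r.
have h2 : M * D <= 2 * (M * D) * (L * (1 + P)).
  have L0 : 0 <= L by lra.
  have := mulr_ge0 L0 P0 => LP.
  have : 1 <= 2 * (L * (1 + P)) by lra.
  by move=> /(ler_wpM2l (ltW MD0)); lra.
rewrite /K; move: h1 h2; lra.
Qed.
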